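(* Let $n\ge 1$ and let $o_{n,n}$ denote the number of orbits of $\widehat{\mathrm{PF}}_{n,n}$ under the action $\tau_{n,n}$ of $S_n$. Then $$o_{n,n}=\frac{1}{n^2}\sum_{e\mid n}\binom{2e-1}{e}F(n/e,e).$$
   Context: For a positive integer $N$ and a positive divisor $d$ of $N$, let $f_N(d)=\frac12$ if $d$ is even and $N/d$ is odd, and $f_N(d)=1$ otherwise. For positive integers $m,e$ define $$F(m,e)=\sum_{d\mid m}\mu\!\left(\frac md\right)f_{me}(d)\,d^2,$$ where $\mu$ is the Möbius function. $S_n$ is the group of permutations of $[n]=\{1,\dots,n\}$; $\pi_i$ denotes the image of $i$ under $\pi$. $\mathbb{Z}_n$ is the set of integers modulo $n$, with representatives in $\{0,\dots,n-1\}$. An integer sequence $(x_1,\dots,x_m)$ is a parking function of length $m$ if its weakly increasing rearrangement $(z_1,\dots,z_m)$ satisfies $0\le z_i\le i-1$ for $i=1,\dots,m$. $\mathrm{PF}_m$ is the set of parking functions of length $m$ ($\mathrm{PF}_0$ consists of the empty sequence). Entries of elements of $\mathrm{PF}_{n-1}$ lie in $\{0,\dots,n-1\}$ and are viewed as elements of $\mathbb{Z}_n$. For $1\le c\le n$ let $$\widehat{\mathrm{PF}}_{n,c}=\Big\{(x_1,\dots,x_n)\in\mathbb{Z}_n^n:\ (x_1,\dots,x_{n-1})\in\mathrm{PF}_{n-1},\ x_n\equiv c-\sum_{i=1}^{n-1}x_i \pmod n\Big\}.$$ Definition of the $S_n$-action $\tau_{n,c}$ on $\widehat{\mathrm{PF}}_{n,c}$: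 for $\pi\in S_n$ and $(x_1,\dots,x_n)\in\widehat{\mathrm{PF}}_{n,c}$, by a theorem of Pollak there is exactly one $y\in\mathbb{Z}_n$ such that $(y+x_{\pi_1},\dots,y+x_{\pi_{n-1}})$ (addition modulo $n$) is in $\mathrm{PF}_{n-1}$; for this $y$ one has $(y+x_{\pi_1},\dots,y+x_{\pi_n})\in\widehat{\mathrm{PF}}_{n,c}$, and one sets $\pi\cdot(x_1,\dots,x_n)=(y+x_{\pi_1},\dots,y+x_{\pi_n})$. Products of permutations are read left to right (first $\pi$, then $\sigma$, in $\pi\sigma$), so that this is a left action. *)

(* Defs.v *)
From mathcomp Require Import all_boot all_order all_algebra all_fingroup.

Set Implicit Arguments.
Unset Strict Implicit.
Unset Printing Implicit Defensive.

Import GRing.Theory.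
Local Open Scope ring_scope.

(* Both functions below are meant for positive arguments only. *)
Definition moebius (m : nat) : rat :=
  if all (fun p => logn p m == 1%N) (primes m)
  then (-1) ^+ size (primes m) else 0.

Definition f (N d : nat) : rat :=
  if ~~ odd d && odd (N %/ d) then 1 / 2%:R else 1.

Definition F (m e : nat) : rat :=
  \sum_(d <- divisors m) moebius (m %/ d) * f (m * e) d * d%:R ^+ 2.

(* The integers modulo n for every n >= 1, as the additive group on
   {0, ..., n-1}; MathComp's 'Z_n has two elements when n = 1. *)
Notation Zmod n := 'I_n.-1.+1.

(* The weakly increasing rearrangement z is indexed from 0 here, so that
   the condition on its i-th entry reads z_i <= i; entries of parking functions
   are nonnegative, hence the use of nat. *)
Definition parking (s : seq nat) : bool :=
  [forall i : 'I_(size s), nth 0%N (sort leq s) i <= i]%N.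

Section Action.

Variable n : nat.
Implicit Types (x : n.-tuple (Zmod n)) (y : Zmod n) (s : 'S_n).

(* (x_1, ..., x_(n-1)), all of x but its last entry. *)
Definition front x : seq (Zmod n) := take n.-1 x.

Definition front_parking x : bool := parking [seq val z | z <- front x].

Definition PFhat (c : nat) : {set n.-tuple (Zmod n)} :=
  [set x : n.-tuple (Zmod n) |
     front_parking x && (last 0 x == inZp c - \sum_(z <- front x) z)].

Definition shift_perm y s x : n.-tuple (Zmod n) :=
  [tuple y + tnth x (s i) | i < n].

(* By Pollak's theorem, exactly one y is picked from; the default value 0 is
   never used. *)
Definition tau s x : n.-tuple (Zmod n) :=
  shift_perm (odflt 0 [pick y | front_parking (shift_perm y s x)]) s x.

Definition tau_orbit x : {set n.-tuple (Zmod n)} := [set tau s x | s : 'S_n].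

Definition tau_orbits (c : nat) : {set {set n.-tuple (Zmod n)}} :=
  [set tau_orbit x | x in PFhat c].

End Action.

Definition orbit_number (n c : nat) : nat := #|tau_orbits n c|.

(* Main.v *)
(** By Pollak's theorem, the orbits of PFhat_{n,n} under tau are the orbits of
    Z_n translating the multisets of size n on Z_n with sum 0.  Burnside's lemma
    for the translations y, together with the filter [sum = 0] written with the
    characters i |-> w^(j i) for a primitive n-th root of unity w, turns n^2
    times the number of orbits into a sum over pairs (y, j) in Z_n^2.  A multiset
    fixed by y is a union of cosets of the subgroup generated by
    e = gcd(y, n), so the term of (y, j) is, up to a sign, the coefficient of X^e
    in prod_(c < e) 1 / (1 - z^c X), where z = w^(j n / e) has order e / g with
    g = gcd(j, y, n).  That product is (1 - X^(e/g))^(-g), so the coefficient is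
    'C(2g - 1, g); the sign is -1 exactly when n is even and y, j are odd.
    Finally F(n/e, e) is the Moebius inversion of the sum of the signs over the
    pairs with g = e, because the sum of the signs over the pairs with D | y and
    D | j is f_n(n/D) (n/D)^2. *)
Require Import Defs.
From mathcomp Require Import all_boot all_order all_algebra all_fingroup.
From mathcomp Require Import all_field zify ring.

Set Implicit Arguments.
Unset Strict Implicit.
Unset Printing Implicit Defensive.

Import GRing.Theory.
Local Open Scope ring_scope.

(** * Parking functions through counts, and the cycle lemma *)

Lemma parkingP (s : seq nat) :
  reflect (forall k, (k <= size s)%N -> (k <= count (fun v => v < k) s)%N)
          (parking s).
Proof.
have srt : sorted leq (sort leq s) by apply: sort_sorted; exact: leq_total.
have sz := size_sort leq s.
have cntE k : count (fun v => v < k)%N s = count (fun v => v < k)%N (sort leq s).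
  by apply/seq.permP; rewrite perm_sym perm_sort.
apply: (iffP forallP) => [park k le_ks | park i].
- rewrite cntE -(cat_take_drop k (sort leq s)) count_cat.
  have -> : count (fun v => v < k)%N (take k (sort leq s)) = k; last by lia.
  have szt : size (take k (sort leq s)) = k by rewrite size_takel ?sz.
  rewrite -[RHS]szt; apply/eqP; rewrite -all_count.
  apply/(all_nthP 0%N) => i; rewrite szt => lt_ik; rewrite nth_take //.
  by have /= := park (Ordinal (leq_trans lt_ik le_ks)); lia.
- rewrite leqNgt; apply/negP => lt_i.
  have := park i.+1 (ltn_ord i).
  rewrite cntE -(cat_take_drop i (sort leq s)) count_cat.
  (* The sorted entries from position [i] on all exceed [i], which leaves at most [i] entries below
     [i.+1]. *)
  have -> : count (fun v => v < i.+1)%N (drop i (sort leq s)) = 0%N.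
    apply/eqP; rewrite -leqn0 leqNgt -has_count; apply/hasPn => v.
    case/(nthP 0%N) => j; rewrite size_drop nth_drop sz => lt_j <-.
    have le_ij : (nth 0 (sort leq s) i <= nth 0 (sort leq s) (i + j))%N.
      by apply: (sorted_leq_nth leq_trans leqnn) => //; rewrite ?inE ?sz; lia.
    by rewrite -leqNgt (leq_trans lt_i).
  have := count_size (fun v => v < i.+1)%N (take i (sort leq s)).
  by rewrite size_takel ?sz; have := ltn_ord i; lia.
Qed.

(** The walk C(i) - i loses exactly 1 over each period of N + 1 steps. Started at its first minimum
    [a] on [0, N], it stays above its start up to N; after N it repeats positions before [a], which
    were strictly higher, lowered by 1. *)
Lemma cycle_lemma N (C : nat -> nat) :
  (forall i, C (i + N.+1)%N = C i + N)%N ->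
  exists2 a, (a <= N)%N & forall k, (k <= N)%N -> (C a + k <= C (a + k))%N.
Proof.
move=> Cper.
(* Lexicographic minimum of (C a - a, a), encoded in base N + 1. *)
pose V (a : 'I_N.+1) := ((C a + N - a) * N.+1 + a)%N.
case: (arg_minnP (P := xpredT) V (i0 := ord0) isT) => a _ amin.
exists a => [|k le_kN]; first by have := ltn_ord a; lia.
have lt_a := ltn_ord a.
case: (ltnP (a + k) N.+1) => [lt_ak | ge_ak].
  by have := amin (Ordinal lt_ak) isT; rewrite /V /=; nia.
have lt_b : (a + k - N.+1 < N.+1)%N by lia.
have := amin (Ordinal lt_b) isT; have := Cper (a + k - N.+1)%N.
rewrite subnK // /V /= => ->; nia.
Qed.

(** For a < b, going from [a] to [b] gives C(a) - a <= C(b) - b, while going from [b] to a + N + 1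
    gives C(b) - b < C(a) - a. *)
Lemma cycle_lemma_uniq N (C : nat -> nat) a b :
  (forall i, C (i + N.+1)%N = C i + N)%N ->
  (a <= N)%N -> (forall k, (k <= N)%N -> (C a + k <= C (a + k))%N) ->
  (b <= N)%N -> (forall k, (k <= N)%N -> (C b + k <= C (b + k))%N) ->
  a = b.
Proof.
move=> Cper; wlog le_ab : a b / (a <= b)%N.
  by move=> W aN aP bN bP; case/orP: (leq_total a b) => ?; [|symmetry]; exact: W.
move=> aN aP bN bP; apply/eqP; rewrite eqn_leq le_ab /= leqNgt; apply/negP => lt_ab.
have := aP (b - a)%N; have := bP (a + N.+1 - b)%N; have := Cper a.
by rewrite subnKC 1?subnKC //; lia.
Qed.

Lemma sum_count_mem (T : finType) (V : nmodType) (G : T -> V) (s : seq T) :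
  \sum_(z <- s) G z = \sum_i G i *+ count_mem i s.
Proof.
elim: s => [|z s IHs]; first by rewrite big_nil big1.
rewrite big_cons {}IHs /=; under [RHS]eq_bigr => i _ do rewrite mulrnDr.
rewrite big_split /=; congr (_ + _).
rewrite (bigD1 z) //= eqxx big1 ?addr0 // => i; rewrite eq_sym.
by case: eqP.
Qed.

Lemma sum_count_mem1 (T : finType) (s : seq T) :
  (\sum_i count_mem i s)%N = size s.
Proof.
rewrite -sum1_size (sum_count_mem (fun=> 1%N)); apply: eq_bigr => i _.
by rewrite -[RHS]/(_%:R) natn.
Qed.

(** * Pollak's theorem *)

Section Pollak.

Variable N : nat.
Implicit Types (s : seq 'I_N.+1) (y : 'I_N.+1).

(** The cumulative count runs along the unrolled circle: when [s] has N entries, each turn adds N,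
    as the cycle lemma requires. *)
Let occ s i := (\sum_(0 <= u < i) count_mem (inZp u : 'I_N.+1) s)%N.

Lemma occ_period s i : size s = N -> (occ s (i + N.+1) = occ s i + N)%N.
Proof.
move=> sz; rewrite /occ (big_cat_nat (n := i)) //=; last by lia.
congr (_ + _)%N; elim: i => [|i IHi].
  rewrite add0n big_mkord; under eq_bigr => u _ do rewrite valZpK.
  by rewrite sum_count_mem1.
have -> : (i.+1 + N.+1 = (i + N.+1).+1)%N by lia.
have lt_i : (i < i + N.+1)%N by lia.
rewrite big_nat_recr //= -[X in (_ + X)%N](_ : count_mem (inZp i) s = _).
  by rewrite addnC -(big_ltn (m := i)).
by congr (count_mem _ _); apply: val_inj => /=; rewrite modnDr.
Qed.

(** Adding [y] carries the arc of length [k] starting at [- y] onto 0, ..., k - 1. Hence [y] makes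
    [s] parking exactly when [- y] is a good starting point for the cycle lemma. *)
Lemma count_shift_lt s y k : (k <= N.+1)%N ->
  (occ s ((- y : 'I_N.+1) + k) =
   occ s (- y : 'I_N.+1) + count (fun v => v < k) [seq val (y + z)%R | z <- s])%N.
Proof.
elim: k => [|k IHk] le_k.
  by rewrite addn0 (@eq_count _ _ pred0) ?count_pred0 ?addn0.
rewrite addnS /occ big_nat_recr //= -/(occ s _) IHk; last exact: ltnW.
rewrite -addnA; congr (_ + _)%N; rewrite !count_map -count_predUI.
have zE : inZp ((- y)%R + k)%N = - y + inZp k :> 'I_N.+1.
  by apply: val_inj; rewrite /= modnDmr.
have eqE z : (z == inZp ((- y)%R + k)%N) = (val (y + z) == k).
  rewrite zE -(inj_eq (addrI y)) addrA subrr add0r -val_eqE /=.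
  by rewrite [X in _ == X]modn_small.
rewrite [X in (_ + X)%N](_ : _ = 0)%N ?addn0; last first.
  apply/eqP; rewrite -leqn0 leqNgt -has_count; apply/hasPn => z _ /=.
  by rewrite eqE /=; case: ltngtP.
apply: eq_count => z.
rewrite -[LHS]/((val (y + z)%R < k)%N || (z == inZp ((- y)%R + k)%N)).
by rewrite eqE orbC -leq_eqVlt.
Qed.

Lemma parking_shiftP s y : size s = N ->
  reflect (forall k, (k <= N)%N ->
             (occ s (- y : 'I_N.+1) + k <= occ s ((- y : 'I_N.+1) + k))%N)
          (parking [seq val (y + z) | z <- s]).
Proof.
move=> sz; apply: (iffP (parkingP _)); rewrite size_map sz => P k le_k;
  by have := P k le_k; rewrite count_shift_lt ?leq_add2l //; exact: leqW.
Qed.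

Lemma pollak_exists s : size s = N ->
  exists y, parking [seq val (y + z) | z <- s].
Proof.
move=> sz; have [a le_a aP] := cycle_lemma (fun i => occ_period i sz).
exists (- inZp a); apply/parking_shiftP => // k le_k.
by rewrite opprK /= modn_small ?ltnS //; exact: aP.
Qed.

Lemma pollak_unique s y y' : size s = N ->
  parking [seq val (y + z) | z <- s] -> parking [seq val (y' + z) | z <- s] ->
  y = y'.
Proof.
move=> sz /(parking_shiftP _ sz) yP /(parking_shiftP _ sz) y'P.
apply: oppr_inj; apply: val_inj.
apply: (cycle_lemma_uniq (fun i => occ_period i sz)) => //; rewrite -ltnS; exact: ltn_ord.
Qed.

End Pollak.

(** * From orbits of tuples to translation orbits of multisets *)

Section Orbits.

Variable N : nat.
Local Notation tuples := (N.+1.-tuple 'I_N.+1).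
Local Notation profiles := {ffun 'I_N.+1 -> 'I_N.+2}.
Local Notation shift := (@shift_perm N.+1).
Implicit Types (x : tuples) (g : profiles) (a y : 'I_N.+1) (s : 'S_N.+1).

(** Encodes the multiset of entries, which is [x] up to permutation. Multiplicities reach N + 1,
    hence the codomain ['I_N.+2], which keeps the type of profiles finite. *)
Definition profile x : profiles := [ffun i => inord (count_mem i x)].

Lemma profileE x i : profile x i = count_mem i x :> nat.
Proof. by rewrite ffunE inordK // ltnS -[X in (_ <= X)%N](size_tuple x) count_size. Qed.

Lemma profile_eq x x' : (profile x == profile x') = perm_eq x x'.
Proof.
apply/eqP/idP => [eq_xx' | /seq.permP eq_xx'].
  by apply/allP => i _ /=; rewrite -!profileE eq_xx'.
by apply/ffunP => i; apply: val_inj; rewrite /= !profileE eq_xx'.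
Qed.

(** The multiset itself moves by [- a], which explains the signs in the lemmas below. *)
Definition translate g a : profiles := [ffun i => g (i + a)].

Lemma translate0 : translate^~ 1%g =1 id.
Proof. by move=> g; apply/ffunP => i; rewrite ffunE addr0. Qed.

Lemma translateD : forall g, act_morph translate g.
Proof.
by move=> g a b; apply/ffunP => i; rewrite !ffunE addrAC addrA.
Qed.

Canonical translation := TotalAction translate0 translateD.

Definition balanced : {set profiles} :=
  [set g : profiles | ((\sum_i g i)%N == N.+1) && (\sum_i i *+ g i == 0)].

Lemma addr_period a : a *+ N.+1 = 0.
Proof. by rewrite Zp_mulrn; apply: val_inj; rewrite /= modnMl. Qed.

(** Translating N + 1 elements by [a] changes their sum by a multiple (N + 1) a, which is 0. *)
Lemma acts_balanced : [acts [set: 'I_N.+1], on balanced | translation].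
Proof.
apply/subsetP => a _; rewrite !inE; apply/subsetP => g; rewrite !inE /=.
case/andP => /eqP sum_g /eqP wsum_g; apply/andP; split; apply/eqP.
  rewrite -[RHS]sum_g [RHS](reindex_inj (addIr a)) /=.
  by apply: eq_bigr => i _; rewrite ffunE.
under eq_bigr => i _ do rewrite ffunE.
transitivity (\sum_i (i - a) *+ g i).
  rewrite [RHS](reindex_inj (addIr a)) /=.
  by apply: eq_bigr => i _; rewrite addrK.
under eq_bigr => i _ do rewrite mulrnBl.
by rewrite sumrB wsum_g sumrMnr sum_g addr_period subr0.
Qed.

Lemma profile_shift_perm y s x :
  profile (shift y s x) = translate (profile x) (- y).
Proof.
have /eqP eq_p : profile [tuple tnth x (s i) | i < N.+1] == profile x.
  by rewrite profile_eq; apply/tuple_permP; exists s.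
apply/ffunP => i; apply: val_inj; rewrite -eq_p [in RHS]ffunE /= !profileE /=.
rewrite !count_map; apply: eq_count => j /=.
by rewrite -(inj_eq (addrI (- y))) addKr addrC.
Qed.

Lemma translate_profileP x x' a :
  profile x' = translate (profile x) a -> exists s, x' = shift (- a) s x.
Proof.
(* Undoing the translation turns [x'] into a tuple with the profile of [x], hence into a
   rearrangement of [x]. *)
move=> eq_x'; pose x0 : tuples := [tuple a + tnth x' i | i < N.+1].
have /tuple_permP[s x0E] : perm_eq x0 x.
  have := profile_shift_perm a 1 x'; rewrite (_ : shift _ _ _ = x0).
    rewrite -profile_eq => ->; rewrite eq_x' -[X in X == _]translateD.
    by rewrite FinRing.zmodMgE subrr [X in X == _]translate0.
  by apply: eq_from_tnth => i; rewrite !tnth_mktuple perm1.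
exists s; apply: eq_from_tnth => i; rewrite tnth_mktuple.
have /(congr1 (fun t : tuples => tnth t i)) : x0 = [tuple tnth x (s i) | i < N.+1].
  exact: val_inj.
by rewrite !tnth_mktuple => <-; rewrite addKr.
Qed.

Lemma front_parking_shift_perm y s x : front_parking (shift y s x) =
  parking [seq val (y + z) | z <- take N [tuple tnth x (s i) | i < N.+1]].
Proof.
rewrite /front_parking /front -!map_take -!map_comp; congr parking.
Qed.

Lemma tau_shift_perm s x :
  exists2 y, tau s x = shift y s x & front_parking (shift y s x).
Proof.
rewrite /tau; case: pickP => [y park | nopark] /=; first by exists y.
set t := [tuple tnth x (s i) | i < N.+1].
have sz : size (take N t) = N by rewrite size_takel // size_tuple.
have [y] := pollak_exists sz.
by rewrite -front_parking_shift_perm nopark.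
Qed.

Lemma tau_eq s x y :
  front_parking (shift y s x) -> tau s x = shift y s x.
Proof.
have [y' -> park'] := tau_shift_perm s x => park; congr shift.
move: park park'; rewrite !front_parking_shift_perm => park park'.
apply: pollak_unique park' park.
by rewrite size_takel // size_tuple.
Qed.

(** The action changes the profile by a translation only. Conversely, a parking tuple whose profile
    is a translate is a shifted permutation of [x], and by uniqueness its shift is the one that
    [tau] selects. *)
Lemma mem_tau_orbit x x' : (x' \in tau_orbit x) =
  front_parking x' && (profile x' \in orbit translation [set: 'I_N.+1] (profile x)).
Proof.
apply/imsetP/andP => [[s _ ->] | [park /orbitP[a _ /esym/translate_profileP[s x'E]]]].
  have [y -> park] := tau_shift_perm s x; split=> //.
  by rewrite profile_shift_perm; apply/orbitP; exists (- y); rewrite ?inE.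
by exists s; rewrite ?(tau_eq (y := - a)) -?x'E.
Qed.

(** Here c = n is 0 modulo n, so the condition on the last entry makes the whole tuple sum to 0. *)
Lemma mem_PFhat x : (x \in PFhat N.+1 N.+1) =
  front_parking x && (\sum_(z <- x) z == 0).
Proof.
rewrite inE; congr (_ && _); rewrite /front /=.
have -> : inZp N.+1 = 0 :> 'I_N.+1 by apply: val_inj; rewrite /= modnn.
rewrite sub0r -addr_eq0; case: x => /= x /eqP.
case/lastP: x => [//|p z]; rewrite size_rcons => -[sz].
by rewrite last_rcons -cats1 take_size_cat // big_cat big_seq1 addrC.
Qed.

Lemma profile_balanced x : (profile x \in balanced) = (\sum_(z <- x) z == 0).
Proof.
rewrite inE; under eq_bigr => i _ do rewrite profileE.
rewrite sum_count_mem1 size_tuple eqxx /= [X in _ = (X == _)]sum_count_mem.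
by congr (_ == _); apply: eq_bigr => i _; rewrite profileE.
Qed.

Lemma profile_surj g : (\sum_i g i)%N = N.+1 -> exists x, profile x = g.
Proof.
move=> sum_g; pose t := flatten [seq nseq (g i) i | i <- enum 'I_N.+1].
have szt : size t == N.+1.
  rewrite size_flatten /shape -map_comp sumnE big_map big_enum /=.
  by apply/eqP; rewrite -[RHS]sum_g; apply: eq_bigr => i _; rewrite size_nseq.
exists (Tuple szt); apply/ffunP => i; apply: val_inj; rewrite /= profileE /=.
rewrite count_flatten -map_comp sumnE big_map big_enum /= (bigD1 i) //=.
rewrite count_nseq /= eqxx mul1n big1 ?addn0 // => j ne_ji.
by rewrite count_nseq /= (negPf ne_ji).
Qed.

Lemma balanced_orbit_parking g : g \in balanced -> exists2 x,
  x \in PFhat N.+1 N.+1 & orbit translation [set: 'I_N.+1] g =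
                          orbit translation [set: 'I_N.+1] (profile x).
Proof.
move=> bal_g; have := bal_g; rewrite inE => /andP[/eqP sum_g _].
have [x0 x0E] := profile_surj sum_g.
have [y _ park] := tau_shift_perm 1 x0; exists (shift y 1 x0); last first.
  apply/esym/orbit_eqP; rewrite profile_shift_perm x0E.
  by apply/orbitP; exists (- y); rewrite ?inE.
rewrite mem_PFhat park -profile_balanced profile_shift_perm x0E /=.
by have /(_ g) /= -> := actsP acts_balanced (- y) (in_setT _).
Qed.

Definition parking_tuples (O : {set profiles}) : {set tuples} :=
  [set x | front_parking x && (profile x \in O)].

(** The bijection is [parking_tuples]. It is injective because every orbit of balanced profiles
    contains the profile of a parking tuple. *)
Lemma card_tau_orbits : #|tau_orbits N.+1 N.+1| =
  #|orbit translation [set: 'I_N.+1] @: balanced|.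
Proof.
have orb_eq g g' : g \in orbit translation [set: 'I_N.+1] g' ->
  orbit translation [set: 'I_N.+1] g = orbit translation [set: 'I_N.+1] g'.
  by move=> gg'; apply: orbit_eqP.
rewrite -(@card_in_imset _ _ parking_tuples).
  apply: eq_card => U; apply/imsetP/imsetP => [[x] | [_ /imsetP[g bal_g ->] ->]].
    rewrite mem_PFhat -profile_balanced => /andP[_ bal_x] ->.
    exists (orbit translation [set: 'I_N.+1] (profile x)); first exact: imset_f.
    by apply/setP => x'; rewrite mem_tau_orbit inE.
  have [x PF_x ->] := balanced_orbit_parking bal_g; exists x => //.
  by apply/setP => x'; rewrite mem_tau_orbit inE.
move=> _ _ /imsetP[g1 bal1 ->] /imsetP[g2 bal2 ->].
have [x1 PF1 ->] := balanced_orbit_parking bal1.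
have [x2 PF2 ->] := balanced_orbit_parking bal2.
move=> /setP/(_ x1); rewrite !inE orbit_refl.
by move: PF1; rewrite mem_PFhat => /andP[-> _] /= /esym/orb_eq.
Qed.

End Orbits.

(** * Truncated geometric series and products over roots of unity *)

Lemma prod_geom (R : comNzRingType) e M d (a : 'I_e -> R) :
  \prod_c (\sum_(v < M.+1) (a c *: 'X^d) ^+ v) =
  \sum_(h : {ffun 'I_e -> 'I_M.+1})
     (\prod_c a c ^+ h c) *: 'X^(d * \sum_c h c).
Proof.
rewrite bigA_distr_bigA /=; apply: eq_bigr => h _.
under eq_bigr => c _ do rewrite exprZn -exprM.
by rewrite scaler_prod big_distrr /= -prodrXr.
Qed.

Lemma coef_prod_geom (R : comNzRingType) e M d q (a : 'I_e -> R) : (0 < d)%N ->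
  (\prod_c (\sum_(v < M.+1) (a c *: 'X^d) ^+ v))`_(d * q) =
  \sum_(h : {ffun 'I_e -> 'I_M.+1} | (\sum_c h c)%N == q) \prod_c a c ^+ h c.
Proof.
move=> d_gt0; rewrite prod_geom coef_sum [RHS]big_mkcond; apply: eq_bigr => h _.
rewrite coefZ coefXn eqn_pmul2l // eq_sym.
by case: eqP; rewrite ?mulr1 ?mulr0.
Qed.

Lemma dvdp_prod_sub1 (F : fieldType) q e (a : 'I_e -> {poly F}) :
  (forall c, 'X^q %| a c) -> 'X^q %| \prod_c (1 - a c) - 1.
Proof.
move=> dv_a; elim/big_rec: _ => [|c p _ IHp]; first by rewrite subrr dvdp0.
have -> : (1 - a c) * p - 1 = (p - 1) - a c * p by ring.
by rewrite dvdp_sub // dvdp_mulr.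
Qed.

(* Uniqueness of inverses modulo X^q: it stands in for formal power series. *)
Lemma coef_inv_mod (F : fieldType) q (A B1 B2 : {poly F}) i : (i < q)%N ->
  'X^q %| A * B1 - 1 -> 'X^q %| A * B2 - 1 -> B1`_i = B2`_i.
Proof.
move=> lt_iq dv1 dv2; apply/eqP; rewrite -subr_eq0 -coefB.
have -> : B1 - B2 = B2 * (A * B1 - 1) - B1 * (A * B2 - 1) by ring.
have /dvdpP[r ->] : 'X^q %| B2 * (A * B1 - 1) - B1 * (A * B2 - 1).
  by rewrite dvdp_sub // dvdp_mull.
by rewrite coefMXn lt_iq.
Qed.

(** Each factor telescopes to 1 - (a c X^d)^(M+1), and the bound on [q] makes this 1 modulo X^q. *)
Lemma dvdp_geom_inv (F : fieldType) q e M d (a : 'I_e -> F) : (q <= d * M.+1)%N ->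
  'X^q %| (\prod_c (1 - a c *: 'X^d)) *
          (\prod_c (\sum_(v < M.+1) (a c *: 'X^d) ^+ v)) - 1.
Proof.
move=> le_q; rewrite -big_split /=.
under eq_bigr => c _.
  have -> (u : {poly F}) : (1 - u) * \sum_(v < M.+1) u ^+ v = 1 - u ^+ M.+1.
    by rewrite -opprB mulNr -subrX1 opprB.
  over.
apply: (@dvdp_prod_sub1 _ q e (fun c => (a c *: 'X^d) ^+ M.+1)) => c.
rewrite exprZn -exprM -(subnK le_q) exprD.
by rewrite -mul_polyC !dvdp_mull.
Qed.

(** The roots of the factors are the powers of [z^-1], again a primitive root, so the product is a
    multiple of X^d - 1. *)
Lemma prod_1subX (F : fieldType) d (z : F) : d.-primitive_root z ->
  \prod_(c < d) (1 - z ^+ c *: 'X) = 1 - 'X^d.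
Proof.
move=> prz.
have z_neq0 : z != 0 by rewrite (prim_root_eq0 prz) -lt0n (prim_order_gt0 prz).
have przV : d.-primitive_root z^-1.
  have d_gt0 := prim_order_gt0 prz.
  have -> : z^-1 = z ^+ d.-1.
    apply: (mulfI z_neq0); rewrite divff // -exprS prednK //.
    by rewrite (prim_expr_order prz).
  by rewrite prim_root_exp_coprime // coprime_sym coprimenP.
pose b : F := \prod_(c < d) (- z ^+ c).
have prodE : \prod_(c < d) (1 - z ^+ c *: 'X) = b *: ('X^d - 1).
  rewrite -(factor_Xn_sub_1 przV) big_mkord /b -scaler_prod.
  apply: eq_bigr => c _; rewrite scalerBr !scaleNr opprK exprVn.
  by rewrite -[_ *: (_)%:P]mul_polyC -polyCM divff ?expf_neq0 // addrC.
(* The constant b is determined by evaluation at 0. *)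
have /(congr1 (fun p => p.[0])) := prodE.
rewrite horner_prod big1 => [|c _]; last by rewrite !hornerE ?mulr0 ?subr0.
rewrite hornerZ !hornerE expr0n gtn_eqF ?(prim_order_gt0 prz) //.
rewrite prodE sub0r mulrN mulr1 => /(congr1 -%R); rewrite opprK => <-.
by rewrite scaleNr scale1r opprB.
Qed.

Lemma prod_1subX_mul (F : fieldType) d g (z : F) : d.-primitive_root z ->
  \prod_(c < g * d) (1 - z ^+ c *: 'X) = (1 - 'X^d) ^+ g.
Proof.
move=> prz.
rewrite -(big_mkord xpredT (fun c => 1 - z ^+ c *: 'X)) big_nat_mul.
rewrite (eq_bigr (fun=> 1 - 'X^d)) => [|i _]; first by rewrite prodr_const_nat subn0.
rewrite -(prod_1subX prz) -{1}(add0n (i * d)%N) big_addn mulSn addnK big_mkord.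
apply: eq_bigr => c _.
by rewrite exprD mulnC exprM (prim_expr_order prz) expr1n mulr1.
Qed.

(** Stars and bars for weak compositions of [g] into [g] parts; functions are turned into tuples to
    apply [card_ord_partitions]. *)
Lemma card_compositions g : (0 < g)%N ->
  #|[set h : {ffun 'I_g -> 'I_g.+1} | (\sum_c h c)%N == g]| = 'C(2 * g - 1, g).
Proof.
case: g => // g _; have -> : (2 * g.+1 - 1 = g + g.+1)%N by lia.
rewrite -[RHS]bin_sub; last by lia.
rewrite (_ : g + g.+1 - g.+1 = g)%N; last by lia.
rewrite -card_ord_partitions.
pose tf (t : g.+1.-tuple 'I_g.+2) := [ffun c => tnth t c].
have tf_inj : injective tf.
  by move=> t t' /ffunP eq_tt'; apply: eq_from_tnth => c; have := eq_tt' c; rewrite !ffunE.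
rewrite -(card_imset _ tf_inj); apply: eq_card => h; rewrite inE.
apply/idP/imsetP => [sum_h | [t]].
  exists [tuple h c | c < g.+1]; last by apply/ffunP=> c; rewrite ffunE tnth_mktuple.
  by rewrite inE big_tuple; under eq_bigr => c _ do rewrite tnth_mktuple.
rewrite inE big_tuple => sum_t ->.
by under eq_bigr => c _ do rewrite ffunE.
Qed.

Lemma sum_root_compositions (F : fieldType) d g e M (z : F) :
    (0 < g)%N -> d.-primitive_root z -> e = (g * d)%N -> (e <= M)%N ->
  \sum_(h : {ffun 'I_e -> 'I_M.+1} | (\sum_c h c)%N == e)
     z ^+ (\sum_(c < e) c * h c) = 'C(2 * g - 1, g)%:R.
Proof.
move=> g_gt0 prz -> le_M; have d_gt0 := prim_order_gt0 prz.
under eq_bigr => h _.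
  rewrite expr_sum; under eq_bigr => c _ do rewrite exprM.
  over.
rewrite -(@coef_prod_geom _ _ M 1 _ (fun c => z ^+ c)) // mul1n.
(* Two inverses of (1 - X^d)^g modulo X^(gd+1): the product over the powers of [z], and [g] copies
   of the geometric series in X^d. Their coefficients at X^(gd) are the two sides. *)
have dv1 := @dvdp_geom_inv F (g * d).+1 (g * d) M 1 (fun c => z ^+ c).
rewrite prod_1subX_mul // in dv1.
have dv2 := @dvdp_geom_inv F (g * d).+1 g g d (fun=> 1).
rewrite prodr_const card_ord [X in (1 - X) ^+ _]scale1r in dv2.
rewrite (coef_inv_mod _ (dv1 _) (dv2 _)) //; [|by lia|by nia].
rewrite (mulnC g d) coef_prod_geom // -card_compositions // -sum1_card natr_sum.
apply: eq_big => h; first by rewrite inE.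
by move=> _; rewrite big1 // => c _; rewrite expr1n.
Qed.

(** * The root of unity filter and the sign of a pair *)

Lemma sum_root_filter (F : fieldType) n (w : F) s : n.-primitive_root w ->
  \sum_(j < n) w ^+ (j * s) = if (n %| s)%N then n%:R else 0.
Proof.
move=> prw; rewrite (prim_order_dvd prw).
under eq_bigr => j _ do rewrite mulnC exprM.
case: eqP => [-> | /eqP w_neq1].
  under eq_bigr => j _ do rewrite expr1n.
  by rewrite sumr_const card_ord.
apply: (mulfI (x := w ^+ s - 1)); first by rewrite subr_eq0.
by rewrite -subrX1 mulr0 -exprM mulnC exprM (prim_expr_order prw) expr1n subrr.
Qed.

Lemma sum_blocks (V : nmodType) n k e (G : nat -> V) : n = (k * e)%N ->
  \sum_(i < n) G i = \sum_(c < e) \sum_(l < k) G (l * e + c)%N.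
Proof.
move=> ->; rewrite exchange_big /= -(big_mkord xpredT G) big_nat_mul big_mkord.
apply: eq_bigr => l _.
rewrite -{1}(add0n (l * e)%N) big_addn mulSn addnK big_mkord.
by apply: eq_bigr => c _; rewrite addnC.
Qed.

Lemma prim_root_half (F : fieldType) n (w : F) : n.-primitive_root w ->
  ~~ odd n -> w ^+ n./2 = -1.
Proof.
move=> prw even_n; have n_gt0 := prim_order_gt0 prw.
have nE : (n./2 * 2 = n)%N by rewrite muln2 -[RHS]odd_double_half (negPf even_n).
apply/eqP; have := sqrf_eq1 (w ^+ n./2).
rewrite -exprM nE (prim_expr_order prw) eqxx -(prim_order_dvd prw).
by case/esym/orP => // /dvdn_leq; lia.
Qed.

(** Integer-valued, so that it can be read both in the field of [w] and in [rat]. *)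
Definition pair_sign n y j : int := if [&& ~~ odd n, odd y & odd j] then -1 else 1.

(* The sum of the coset c + eZ of Z_n is k c + e 'C(k, 2); the second term,
   summed over e cosets, is where the sign comes from. *)
Lemma root_exp_bin2 (F : fieldType) n k e y j (w : F) : n.-primitive_root w ->
  n = (k * e)%N -> e = gcdn y n ->
  w ^+ (j * (e * (e * 'C(k, 2)))) = (pair_sign n y j)%:~R.
Proof.
move=> prw nE eE; have n_gt0 := prim_order_gt0 prw.
have odd_e : ~~ odd n -> odd e = odd y.
  move=> even_n; apply: negb_inj; rewrite -!dvdn2 eE dvdn_gcd [(2 %| n)%N]dvdn2.
  by rewrite even_n andbT.
rewrite /pair_sign; case: (boolP (odd k)) => [odd_k | even_k].
  have -> : [&& ~~ odd n, odd y & odd j] = false.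
    apply/negP => /and3P[even_n odd_y _].
    by move: (even_n); rewrite nE oddM odd_k (odd_e even_n) odd_y.
  apply/eqP; rewrite -(prim_order_dvd prw) bin2odd // nE.
  by rewrite dvdn_mull // [(k * e)%N]mulnC dvdn_mul // dvdn_mull // dvdn_mulr.
have even_n : ~~ odd n by rewrite nE oddM negb_and even_k.
rewrite even_n /= -(odd_e even_n).
(* As n = k e, the factor e 'C(k, 2) is n/2 times the odd number k - 1, and w^(n/2) = -1: only the
   parity of j e matters. *)
have -> : (j * (e * (e * 'C(k, 2))) = n./2 * (j * e * k.-1))%N.
  have [k2 kE] : exists k2, k = k2.*2.
    by exists k./2; rewrite -[LHS]odd_double_half (negPf even_k).
  rewrite nE bin2 kE -!doubleMl !doubleK; nia.
rewrite exprM (prim_root_half prw) // -signr_odd !oddM.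
have -> : odd k.-1 by case: (k) nE even_k n_gt0 => [-> //|k' _ /=]; rewrite negbK.
by rewrite andbT andbC; case: ifP.
Qed.

(** * Profiles fixed by a translation, and Burnside's count *)

Section FixedProfiles.

Variable N : nat.
Local Notation profiles := {ffun 'I_N.+1 -> 'I_N.+2}.

(** In Z_(N+1), [y] and [e] generate the same subgroup, so invariance under [y] is periodicity with
    period [e]. *)
Lemma translate_fixP (y : 'I_N.+1) (g : profiles) e : e = gcdn y N.+1 ->
  reflect (forall i, g i = g (inZp (i %% e))) (translate g y == g).
Proof.
move=> eE.
have e_gt0 : (0 < e)%N by rewrite eE gcdn_gt0 orbT.
apply: (iffP eqP) => [/ffunP fix_y i | g_mod]; last first.
  apply/ffunP => i; rewrite ffunE g_mod [RHS]g_mod /=; congr (g (inZp _)).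
  have dv_n : (e %| N.+1)%N by rewrite eE dvdn_gcdr.
  rewrite modn_dvdm // -modnDmr (_ : y %% e = 0)%N ?addn0 //.
  by apply/eqP; rewrite -/(e %| y)%N eE dvdn_gcdl.
have step m : forall i, g (i + y *+ m) = g i.
  elim: m => [|m IHm] j; first by rewrite mulr0n addr0.
  by rewrite mulrSr addrA -[RHS](IHm j) -[RHS]fix_y ffunE.
(* Bezout, with y = 0 treated apart: there e = N + 1, which is 0 in the group. *)
have [m mE] : exists m, y *+ m = inZp e.
  case: (posnP y) => [y0 | y_gt0].
    exists 0%N; apply: val_inj; rewrite /= eE y0 gcd0n modnn //.
  case: (egcdnP N.+1 y_gt0) => km kn E _; exists km; rewrite Zp_mulrn.
  by apply: val_inj; rewrite /= mulnC E -eE modnMDl.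
rewrite {1}(_ : i = inZp (i %% e) + y *+ (m * (i %/ e))) ?step //.
rewrite mulrnA mE Zp_mulrn; apply: val_inj; rewrite /= modnDml modnDmr.
rewrite -modnDmr modnMml modnDmr addnC mulnC -divn_eq.
by rewrite modn_small.
Qed.

Lemma sum_fixed_profiles (F : fieldType) (w : F) (y : 'I_N.+1) j :
    N.+1.-primitive_root w ->
  \sum_(g : profiles | ((\sum_i g i)%N == N.+1) && (translate g y == g))
     w ^+ (j * \sum_(i < N.+1) i * g i) =
  (pair_sign N.+1 y j)%:~R * 'C(2 * gcdn j (gcdn y N.+1) - 1, gcdn j (gcdn y N.+1))%:R.
Proof.
move=> prw; set e := gcdn y N.+1; set g0 := gcdn j e.
have e_gt0 : (0 < e)%N by rewrite gcdn_gt0 orbT.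
have le_e : (e <= N.+1)%N by rewrite dvdn_leq ?dvdn_gcdr.
pose k := (N.+1 %/ e)%N; have nE : N.+1 = (k * e)%N by rewrite divnK ?dvdn_gcdr.
pose red i : 'I_e := Ordinal (ltn_pmod i e_gt0).
have redD l (c : 'I_e) : red (l * e + c)%N = c.
  by apply: val_inj; rewrite /= modnMDl modn_small.
(* Fixed profiles are the periodic extensions of functions [h] on 0, ..., e - 1, and total size N +
   1 = k e becomes total [e] for [h]. *)
pose lift (h : {ffun 'I_e -> 'I_N.+2}) : profiles := [ffun i => h (red (val i))].
pose restr (g : profiles) : {ffun 'I_e -> 'I_N.+2} := [ffun c => g (inZp (val c))].
have liftE h i : lift h i = h (red (val i)) by rewrite ffunE.
have liftK h : restr (lift h) = h.
  apply/ffunP => c; rewrite !ffunE; congr (h _); apply: val_inj => /=.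
  by rewrite !modn_small // (leq_trans (ltn_ord c)).
have sum_lift h : (\sum_i lift h i = k * \sum_c h c)%N.
  under [LHS]eq_bigr => i _ do rewrite liftE.
  rewrite (sum_blocks (fun i => h (red i) : nat) nE) big_distrr /=.
  apply: eq_bigr => c _; under eq_bigr => l _ do rewrite redD.
  by rewrite sum_nat_const card_ord.
have wsum_lift h : (\sum_(i < N.+1) i * lift h i =
                    k * \sum_(c < e) c * h c + e * 'C(k, 2) * \sum_c h c)%N.
  under [LHS]eq_bigr => i _ do rewrite liftE.
  rewrite (sum_blocks (fun i => i * h (red i) : nat)%N nE) !big_distrr -big_split /=.
  apply: eq_bigr => c _; under eq_bigr => l _ do rewrite redD mulnDl.
  rewrite big_split /= sum_nat_const card_ord addnC; congr (_ + _)%N.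
  rewrite -big_distrl /= -big_distrl /= -triangular_sum big_mkord.
  by rewrite [(e * _)%N]mulnC.
rewrite (reindex_onto lift restr) /= => [|g /andP[_ /(translate_fixP g (erefl e)) g_mod]].
  have lift_fix h : translate (lift h) y == lift h.
    apply/(translate_fixP _ (erefl e)) => i; rewrite !liftE; congr (h _).
    apply: val_inj => /=; rewrite (@modn_small (i %% e)) ?modn_mod //.
    by rewrite (leq_trans (ltn_pmod i e_gt0)).
  have k_gt0 : (0 < k)%N by move: (ltn0Sn N); rewrite nE muln_gt0 => /andP[].
  have condE q : (k * q == N.+1)%N = (q == e) by rewrite nE eqn_pmul2l.
  rewrite (eq_bigl (fun h : {ffun 'I_e -> 'I_N.+2} => (\sum_c h c)%N == e)); last first.
    by move=> h; rewrite lift_fix liftK eqxx !andbT sum_lift condE.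
  under eq_bigr => h /eqP sum_h.
    rewrite wsum_lift sum_h mulnDr [(e * _ * e)%N]mulnC exprD.
    rewrite (root_exp_bin2 j prw nE (erefl e)) mulnA exprM.
    over.
  rewrite -big_distrl mulrC /=; congr (_ * _).
  have g0_gt0 : (0 < g0)%N by rewrite gcdn_gt0 e_gt0 orbT.
  apply: (@sum_root_compositions _ (e %/ g0)) => //.
  (* The order of w^(j k) is k e / gcd(j k, k e) = e / gcd(j, e). *)
  - have := exp_prim_root prw (j * k); rewrite {1 2}nE [(k * e)%N]mulnC -muln_gcdl.
    by rewrite divnMr.
  - by rewrite mulnC divnK ?dvdn_gcdr.
apply/ffunP => i; rewrite liftE ffunE [RHS]g_mod; congr (g (inZp _)).
Qed.

Lemma sum_inZp (G : 'I_N.+1 -> nat) :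
  \sum_i inZp (G i) = inZp (\sum_i G i) :> 'I_N.+1.
Proof.
rewrite (big_morph (id1 := 0) (op1 := +%R) (inZp : nat -> 'I_N.+1)) //.
- by move=> a b; apply: val_inj; rewrite /= modnDm.
- by apply: val_inj; rewrite /= mod0n.
Qed.

Lemma balancedE (g : profiles) : (g \in balanced N) =
  ((\sum_i g i)%N == N.+1) && (N.+1 %| \sum_(i < N.+1) i * g i)%N.
Proof.
rewrite inE; congr (_ && _); under eq_bigr => i _ do rewrite Zp_mulrn.
by rewrite sum_inZp -val_eqE /= .
Qed.

Lemma card_fixed_profiles (F : fieldType) (w : F) (y : 'I_N.+1) :
    N.+1.-primitive_root w ->
  (#|'Fix_(balanced N | translation N)[y]%g| * N.+1)%:R =
  \sum_(j < N.+1) (pair_sign N.+1 y j)%:~R *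
    'C(2 * gcdn j (gcdn y N.+1) - 1, gcdn j (gcdn y N.+1))%:R :> F.
Proof.
move=> prw; under eq_bigr => j _ do rewrite -(sum_fixed_profiles _ _ prw).
rewrite exchange_big /=.
under eq_bigr => g _ do rewrite (sum_root_filter _ prw).
rewrite natrM mulr_natl -sumr_const -big_mkcondr /= .
apply: eq_bigl => g; rewrite inE balancedE.
have -> : (g \in afix (translation N) [set y]) = (translate g y == g) by apply/afix1P/eqP.
by rewrite andbAC.
Qed.

(** One factor N + 1 is the group order in Burnside's lemma, the other comes from the root of unity
    filter. *)
Lemma card_orbits_sum (F : fieldType) (w : F) :
    N.+1.-primitive_root w ->
  (#|tau_orbits N.+1 N.+1| * N.+1 ^ 2)%:R =
  \sum_(y < N.+1) \sum_(j < N.+1) (pair_sign N.+1 y j)%:~R *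
    'C(2 * gcdn j (gcdn y N.+1) - 1, gcdn j (gcdn y N.+1))%:R :> F.
Proof.
move=> prw; rewrite card_tau_orbits expnSr expn1 mulnA.
have := Frobenius_Cauchy (acts_balanced N); rewrite cardsT card_ord => <-.
rewrite big_distrl natr_sum; apply: eq_big => [y|y _]; first by rewrite inE.
exact: (card_fixed_profiles _ prw).
Qed.

End FixedProfiles.

(** * Moebius inversion and the sums of signs *)

Lemma perm_primesM p d : prime p -> (0 < d)%N -> ~~ (p %| d)%N ->
  perm_eq (primes (p * d)) (p :: primes d).
Proof.
move=> pr_p d_gt0 ndv; apply: uniq_perm; first exact: primes_uniq.
  by rewrite /= primes_uniq mem_primes pr_p d_gt0 ndv.
by move=> q; rewrite primesM ?(prime_gt0 pr_p) // (primes_prime pr_p) !inE.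
Qed.

Lemma moebiusM p d : prime p -> (0 < d)%N ->
  moebius (p * d) = if (p %| d)%N then 0 else - moebius d.
Proof.
move=> pr_p d_gt0; have p_gt0 := prime_gt0 pr_p; rewrite /moebius.
case: (boolP (p %| d)%N) => [dv | ndv].
  case: ifP => // /allP/(_ p); rewrite mem_primes pr_p muln_gt0 p_gt0 d_gt0.
  rewrite dvdn_mulr // lognM // logn_prime // eqxx => /(_ isT).
  by rewrite add1n eqSS lognE pr_p d_gt0 dv.
rewrite (perm_all _ (perm_primesM pr_p d_gt0 ndv)).
rewrite (perm_size (perm_primesM pr_p d_gt0 ndv)) /=.
rewrite lognM // logn_prime // eqxx (lognE p d) (negPf ndv) !andbF /=.
rewrite (@eq_in_all _ _ (fun q => logn q d == 1%N)) => [|q].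
  by case: ifP => _; rewrite ?oppr0 // exprS mulN1r.
rewrite mem_primes => /and3P[pr_q _ dv_q]; rewrite lognM // logn_prime //.
by case: (q =P p) dv_q ndv => // -> ->.
Qed.

(** For a prime [p] dividing [k], a divisor [d] prime to [p] cancels against [p * d]; the multiples
    of p^2 contribute 0. *)
Lemma sum_moebius k : (0 < k)%N ->
  \sum_(d <- divisors k) moebius d = (k == 1)%N%:R.
Proof.
move=> k_gt0; case: (eqVneq k 1%N) => [-> | k_neq1].
  by rewrite big_seq1.
have [p pr_p dv_pk] : exists2 p, prime p & (p %| k)%N.
  by exists (pdiv k); rewrite ?pdiv_prime ?pdiv_dvd //; lia.
have p_gt0 := prime_gt0 pr_p.
have kp_gt0 : (0 < k %/ p)%N by rewrite divn_gt0 // dvdn_leq.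
rewrite (bigID (fun d => p %| d)%N) /= -big_filter.
have permd : perm_eq [seq d <- divisors k | p %| d]%N
                     [seq (p * d)%N | d <- divisors (k %/ p)].
  apply: uniq_perm; first by rewrite filter_uniq ?divisors_uniq.
    rewrite map_inj_uniq ?divisors_uniq // => a b /eqP.
    by rewrite eqn_pmul2l // => /eqP.
  move=> d; rewrite mem_filter -dvdn_divisors //.
  apply/andP/mapP => [[/dvdnP[d' ->] dv] | [d' dv ->]].
    exists d'; last exact: mulnC.
    by rewrite -dvdn_divisors // dvdn_divRL.
  rewrite dvdn_mulr //; split=> //; rewrite mulnC -dvdn_divRL //.
  by rewrite dvdn_divisors.
rewrite (perm_big _ permd) big_map /= [X in X + _](_ : _ =
    - \sum_(d <- divisors (k %/ p) | ~~ (p %| d)%N) moebius d); last first.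
  rewrite -sumrN [RHS]big_mkcond [LHS]big_seq [RHS]big_seq; apply: eq_bigr => d.
  rewrite -dvdn_divisors // => dv; rewrite moebiusM ?(dvdn_gt0 _ dv) //.
  by case: ifP.
apply/eqP; rewrite addrC subr_eq0 -big_filter -[X in _ == X]big_filter; apply/eqP.
apply: perm_big; apply: uniq_perm; rewrite ?filter_uniq ?divisors_uniq //.
move=> d; rewrite !mem_filter -!dvdn_divisors //; case: (boolP (p %| d)%N) => //= ndv.
have cop : coprime d p by rewrite coprime_sym prime_coprime.
by rewrite -{1}(divnK dv_pk) Gauss_dvdl.
Qed.

(** With G = gcd(j, y, n), the surviving [d] are the divisors of G / e, or none if [e] does not
    divide G; [sum_moebius] then detects G / e = 1. *)
Lemma moebius_gcd_indicator n e y j : (0 < n)%N -> (e %| n)%N ->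
  \sum_(d <- divisors (n %/ e))
     moebius d * ((e * d %| y)%N && (e * d %| j)%N)%:R
  = (gcdn j (gcdn y n) == e)%:R.
Proof.
move=> n_gt0 dv_en; set G := gcdn j _.
have e_gt0 := dvdn_gt0 n_gt0 dv_en.
have m_gt0 : (0 < n %/ e)%N by rewrite divn_gt0 // dvdn_leq.
have G_gt0 : (0 < G)%N by rewrite !gcdn_gt0 n_gt0 !orbT.
have dvGE d : (d %| n %/ e)%N -> (e * d %| y)%N && (e * d %| j)%N = (e * d %| G)%N.
  by rewrite dvdn_divRL // mulnC => dv; rewrite !dvdn_gcd dv andbT andbC.
have [/dvdnP[q GE] | ndv] := boolP (e %| G)%N; last first.
  rewrite big_seq big1 => [|d]; last first.
    rewrite -dvdn_divisors // => /dvGE ->; case: (boolP (e * d %| G)%N) => [dv|_].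
      by case/negP: ndv; apply: dvdn_trans dv; rewrite dvdn_mulr.
    by rewrite mulr0.
  by case: eqP ndv => // ->; rewrite dvdnn.
have q_gt0 : (0 < q)%N by move: G_gt0; rewrite GE muln_gt0 => /andP[].
have dv_q : (q %| n %/ e)%N.
  by rewrite dvdn_divRL // -GE /G (dvdn_trans (dvdn_gcdr _ _)) ?dvdn_gcdr.
transitivity (\sum_(d <- divisors q) moebius d); last first.
  by rewrite sum_moebius // GE -{2}[e]mul1n eqn_pmul2r.
transitivity (\sum_(d <- [seq d <- divisors (n %/ e) | d %| q]%N) moebius d); last first.
  apply: perm_big; apply: uniq_perm; rewrite ?filter_uniq ?divisors_uniq //.
  move=> d; rewrite mem_filter -!dvdn_divisors //; apply: andb_idr => dv.
  exact: dvdn_trans dv_q.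
rewrite big_filter [RHS]big_mkcond [LHS]big_seq [RHS]big_seq; apply: eq_bigr => d.
rewrite -dvdn_divisors // => /dvGE ->; rewrite GE [(q * e)%N]mulnC dvdn_pmul2l //.
by case: ifP; rewrite ?mulr1 ?mulr0.
Qed.

Lemma sum_odd_multiples d D :
  (\sum_(t < d) odd (t * D))%N = (if odd D then d./2 else 0)%N.
Proof.
case: ifP => odd_D; under eq_bigr => t _ do rewrite oddM odd_D ?andbT ?andbF.
  elim: d => [|d IHd]; first by rewrite big_ord0.
  by rewrite big_ord_recr /= IHd uphalf_half addnC.
by rewrite big1.
Qed.

Lemma sum_multiples (V : nmodType) n d D (G : nat -> V) : (0 < D)%N ->
  n = (d * D)%N -> \sum_(y < n | (D %| y)%N) G y = \sum_(t < d) G (t * D)%N.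
Proof.
move=> D_gt0 nE; rewrite big_mkcond.
rewrite (sum_blocks (fun y => if (D %| y)%N then G y else 0) nE).
rewrite (bigD1 (Ordinal D_gt0)) //= [X in _ + X]big1 ?addr0 => [|c c_neq0].
  by apply: eq_bigr => t _; rewrite addn0 dvdn_mull.
apply: big1 => t _; rewrite dvdn_addr ?dvdn_mull // gtnNdvd ?lt0n //.
Qed.

Lemma sum_pair_sign n d D : (0 < n)%N -> n = (d * D)%N ->
  \sum_(y < n | (D %| y)%N) \sum_(j < n | (D %| j)%N) (pair_sign n y j)%:~R =
  f n d * d%:R ^+ 2.
Proof.
move=> n_gt0 nE; have /andP[d_gt0 D_gt0] : (0 < d)%N && (0 < D)%N.
  by rewrite -muln_gt0 -nE.
under eq_bigr => y _ do
  rewrite (sum_multiples (fun j => (pair_sign n y j)%:~R) D_gt0 nE).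
rewrite (sum_multiples
  (fun y => \sum_(u < d) (pair_sign n y (u * D)%N)%:~R) D_gt0 nE).
pose o t : rat := (odd (t * D))%:R.
(* Written as a polynomial in the parities, the sign lets the double sum factor. For n even and D
   odd, d/2 of the [o t] are 1, and d^2 - 2 (d/2)^2 = d^2 / 2 accounts for the value 1/2 of [f]. *)
have signE t u : (pair_sign n (t * D) (u * D))%:~R =
    1 - (~~ odd n)%:R * 2%:R * o t * o u :> rat.
  by rewrite /pair_sign /o; do 3!case: odd; rewrite /=; ring.
have -> : \sum_(t < d) \sum_(u < d) (pair_sign n (t * D) (u * D))%:~R =
    d%:R ^+ 2 - (~~ odd n)%:R * 2%:R * (\sum_(t < d) o t) ^+ 2.
  under eq_bigr => t _.
    under eq_bigr => u _ do rewrite signE.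
    rewrite sumrB sumr_const card_ord -mulr_sumr; over.
  rewrite sumrB sumr_const card_ord -mulr_suml -mulr_sumr.
  by rewrite -[X in X - _ = _]mulr_natr !expr2 mulrA.
rewrite /o -natr_sum sum_odd_multiples /f nE oddM mulKn //.
case: (boolP (odd D)) => odd_D; case: (boolP (odd d)) => odd_d /=; try by ring.
have -> : d%:R = (d./2)%:R * 2%:R :> rat.
  by rewrite -natrM muln2 -{1}[d]odd_double_half (negPf odd_d).
by field.
Qed.

Lemma sum_pair_sign_gcd n e : (0 < n)%N -> (e %| n)%N ->
  \sum_(y < n) \sum_(j < n) (pair_sign n y j)%:~R * (gcdn j (gcdn y n) == e)%:R =
  F (n %/ e) e.
Proof.
move=> n_gt0 dv_en; have e_gt0 := dvdn_gt0 n_gt0 dv_en.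
have m_gt0 : (0 < n %/ e)%N by rewrite divn_gt0 // dvdn_leq.
transitivity (\sum_(d <- divisors (n %/ e)) moebius d *
    (\sum_(y < n | (e * d %| y)%N) \sum_(j < n | (e * d %| j)%N)
       (pair_sign n y j)%:~R)).
  under eq_bigr => y _ do under eq_bigr => j _ do
    rewrite -(moebius_gcd_indicator y j n_gt0 dv_en) mulr_sumr.
  under eq_bigr => y _ do rewrite exchange_big /=.
  rewrite exchange_big; apply: eq_bigr => d _ /=.
  rewrite mulr_sumr [RHS]big_mkcond; apply: eq_bigr => y _.
  case: ifP => _; last by rewrite big1 // => j _; rewrite !mulr0.
  rewrite mulr_sumr [RHS]big_mkcond; apply: eq_bigr => j _.
  by case: ifP => _ /=; rewrite ?mulr0 // mulr1 mulrC.
rewrite /F divnK //.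
(* The sum of signs for D = e d involves n / D = (n/e) / d, so [F] is matched through the involution
   d -> (n/e) / d on divisors. *)
have permd : perm_eq (divisors (n %/ e)) [seq (n %/ e %/ d)%N | d <- divisors (n %/ e)].
  have divK d : d \in divisors (n %/ e) -> (n %/ e %/ (n %/ e %/ d))%N = d.
    by rewrite -dvdn_divisors // => dv; rewrite divnA // mulKn.
  apply: uniq_perm; rewrite ?divisors_uniq //.
    rewrite map_inj_in_uniq ?divisors_uniq // => a b /divK {2}<- /divK {2}<- -> //.
  move=> d; apply/idP/mapP => [dv | [d' dv ->]].
    by exists (n %/ e %/ d)%N; rewrite ?divK // -dvdn_divisors // dvdn_div // dvdn_divisors.
  by move: dv; rewrite -!dvdn_divisors // => /dvdn_div.
rewrite [RHS](perm_big _ permd) big_map big_seq [RHS]big_seq; apply: eq_bigr => d.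
rewrite -dvdn_divisors // => dv; rewrite (@sum_pair_sign n (n %/ e %/ d)) //.
  by rewrite divnA // mulKn // mulrA.
by rewrite -divnMA divnK // mulnC -dvdn_divRL.
Qed.

(** * Assembling the orbit formula *)

Theorem theorem5p2 (n : nat) (n_gt0 : (0 < n)%N) :
  (orbit_number n n)%:R =
    1 / n%:R ^+ 2 * \sum_(e <- divisors n) 'C(2 * e - 1, e)%:R * F (n %/ e) e
  :> rat.
Proof.
have [w prw] := C_prim_root_exists n_gt0.
pose B y j : nat := 'C(2 * gcdn j (gcdn y n) - 1, gcdn j (gcdn y n)).
(* The root [w] lives in [algC], the claim in [rat]. Both sides of the count are integers, so the
   identity descends from [algC] to [int] and then maps to [rat]. *)
pose X : int := \sum_(y < n) \sum_(j < n) pair_sign n y j * (B y j)%:R.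
have XE (R : comNzRingType) :
    X%:~R = \sum_(y < n) \sum_(j < n) (pair_sign n y j)%:~R * (B y j)%:R :> R.
  rewrite rmorph_sum; apply: eq_bigr => y _; rewrite rmorph_sum.
  by apply: eq_bigr => j _; rewrite rmorphM rmorph_nat.
have orbE : (orbit_number n n * n ^ 2)%:R =
    \sum_(y < n) \sum_(j < n) (pair_sign n y j)%:~R * (B y j)%:R :> rat.
  suff XE' : (orbit_number n n * n ^ 2)%:R = X by rewrite -XE -XE' rmorph_nat.
  apply: (intr_inj (R := algC)); rewrite XE rmorph_nat {X XE}/B.
  by case: n n_gt0 prw => // N _; exact: card_orbits_sum.
have n_neq0 : n%:R != 0 :> rat by rewrite Num.Theory.pnatr_eq0 -lt0n.
apply: (mulIf (expf_neq0 2 n_neq0)); rewrite -natrX -natrM orbE natrX.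
transitivity (\sum_(e <- divisors n) 'C(2 * e - 1, e)%:R * F (n %/ e) e); last first.
  by field.
rewrite [RHS]big_seq.
under [RHS]eq_bigr => e.
  rewrite -dvdn_divisors // => dv; rewrite -sum_pair_sign_gcd // mulr_sumr.
  under eq_bigr => y _ do rewrite mulr_sumr.
  over.
rewrite -big_seq [RHS]exchange_big; apply: eq_bigr => y _ /=.
rewrite [RHS]exchange_big; apply: eq_bigr => j _ /=.
(* For a fixed pair (y, j), only the divisor e = gcd(j, y, n) contributes. *)
rewrite [RHS](bigD1_seq (gcdn j (gcdn y n))) ?divisors_uniq //=; last first.
  by rewrite -dvdn_divisors // (dvdn_trans (dvdn_gcdr _ _)) ?dvdn_gcdr.
rewrite eqxx mulr1 big1 ?addr0 => [|e ne_e]; first by rewrite mulrC.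
by rewrite eq_sym (negPf ne_e) !mulr0.
Qed.
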